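(* Let $K_{\mathrm{Lap}}(s,t)=\exp(-|s-t|)$ on $\mathbb{R}$. Fix a compact interval $I=[a,b]\subset\mathbb{R}$. Then the functional $\mu\mapsto H_{K_{\mathrm{Lap}}}(\mu)$ is concave on the set of Borel probability measures $\mu$ supported on $I$. Equivalently, for all such $\mu_0,\mu_1$ and all $\lambda\in[0,1]$, $$H_{K_{\mathrm{Lap}}}\bigl(\lambda\mu_0+(1-\lambda)\mu_1\bigr)\ \ge\ \lambda H_{K_{\mathrm{Lap}}}(\mu_0)+(1-\lambda)H_{K_{\mathrm{Lap}}}(\mu_1).$$
   Context: For a Borel probability measure $\mu$ on $\mathbb{R}$ and a measurable symmetric $K:\mathbb{R}\times\mathbb{R}\to[0,1]$ with $K(s,s)=1$, the $K$-entropy is $H_K(\mu):=\int_{\mathbb{R}}-\log\Bigl(\int_{\mathbb{R}}K(s,t)\,d\mu(t)\Bigr)\,d\mu(s)\in[0,\infty]$, with $-\log 0:=+\infty$. *)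

(* Defs.v *)
From HB Require Import structures.
From mathcomp Require Import all_boot all_order all_algebra.
From mathcomp Require Import all_classical all_reals all_analysis.
Import Order.TTheory GRing.Theory Num.Theory.
Import numFieldNormedType.Exports.

Set Implicit Arguments.
Unset Strict Implicit.
Unset Printing Implicit Defensive.

Local Open Scope classical_set_scope.
Local Open Scope ring_scope.

Section mixture.
Context d (T : measurableType d) (R : realType).
Variables (l : {i01 R}) (mu nu : probability T R).

Definition mixture : set T -> \bar R :=
  measure_add (mscale l%:num%:nng mu) (mscale (1 - l%:num)%:nng nu).

HB.instance Definition _ := Measure.on mixture.

Lemma mixtureE (A : set T) :
  mixture A = (l%:num%:E * mu A + (1 - l%:num)%:E * nu A)%E.
Proof. by rewrite /mixture measure_addE. Qed.

Let mixture_setT : mixture [set: T] = 1%E.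
Proof.
by rewrite mixtureE !probability_setT !mule1 -EFinD addrC subrK.
Qed.

HB.instance Definition _ :=
  Measure_isProbability.Build _ _ _ mixture mixture_setT.

End mixture.

Section entropy.
Context (R : realType).
Implicit Types mu : probability (measurableTypeR R) R.

(* lne is the extended logarithm, with lne 0 = -oo, so the integrand of the
   outer integral is +oo where the inner integral vanishes. *)
Definition Kentropy (K : R -> R -> R) mu : \bar R :=
  (\int[mu]_s - lne (\int[mu]_t (K s t)%:E))%E.

Definition laplace_kernel (s t : R) : R := expR (- `|s - t|).

Definition supported_on mu (I : set R) : Prop := mu (~` I) = 0%E.

End entropy.

(* Main.v *)
Require Import Defs.
From HB Require Import structures.
From mathcomp Require Import all_boot all_order all_algebra.
From mathcomp Require Import all_classical all_reals all_analysis.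
From mathcomp Require Import measurable_realfun ring lra zify.
Import Order.TTheory GRing.Theory Num.Theory.
Import numFieldNormedType.Exports.
Local Open Scope classical_set_scope.
Local Open Scope ring_scope.

(** The exponential kernel is the Green function of a second order operator:
    with F = K mu one has 2 mu = F - F'' as distributions, so an integration by
    parts would turn minus the entropy into half the integral of
    F log F + F'^2 / F, which is convex in F. The proof below is the
    finite-difference version of this computation.

    Cut a neighbourhood of [a, b] into cells of width h and let p i be the mass
    of the i-th cell. Replacing |s - t| by h |i - j| when s and t lie in the
    cells i and j changes the kernel by a factor between e^-h and e^h, hence
    also the potential F, hence log F by at most h. The entropy of mu is
    therefore within h of the discrete entropy - \sum_i p i * ln (f i), where
    f i = \sum_j r ^ |i - j| * p j and r = e^-h ([Kentropy_grid]). The masses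
    p i are affine in mu, so it suffices to prove that the discrete entropy is
    concave in p, and then to let h tend to 0.

    The matrix r ^ |i - j| has a tridiagonal inverse, up to the factor
    1 - r^2, whose off-diagonal entries are nonpositive and whose column sums
    are nonnegative ([precision_potential], [precision_offdiag],
    [precision_colsum]). Writing p = A f for such a matrix A,

      \sum_i p i * ln (f i)
        = \sum_j (\sum_i A i j) * f j * ln (f j)
          + \sum_(i != j) (- A i j) * f j * ln (f j / f i),

    a nonnegative combination of the jointly convex functions x ln (x / y)
    evaluated at linear functions of p ([dual_entropy_convex]). *)

Set Implicit Arguments.
Unset Strict Implicit.

(** * Joint convexity of x ln (x / y) *)

(** Since x (ln x - ln y) is homogeneous of degree 1, it lies above its tangent
    plane at (X, Y), which passes through the origin; the inequality is
    ln z <= z - 1 at z = (y X) / (x Y). *)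
Lemma relative_entropy_tangent (R : realType) (x y X Y : R) :
  0 < x -> 0 < y -> 0 < X -> 0 < Y ->
  x * (ln X - ln Y) + x - y * (X / Y) <= x * (ln x - ln y).
Proof.
move=> x0 y0 X0 Y0.
have z0 : 0 < y * X / (x * Y) by rewrite divr_gt0 ?mulr_gt0.
have : ln (y * X / (x * Y)) <= y * X / (x * Y) - 1.
  rewrite -[in leLHS](subrK 1 (y * X / (x * Y))) addrC.
  by apply: le_ln1Dx; rewrite ltrBrDr addNr.
rewrite ln_div ?posrE ?mulr_gt0// !lnM ?posrE//.
move/(ler_wpM2l (ltW x0)).
have -> : x * (y * X / (x * Y) - 1) = y * (X / Y) - x.
  by field; rewrite !gt_eqF.
lra.
Qed.

Lemma mix_gt0 (R : realType) (t x y : R) :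
  0 <= t <= 1 -> 0 < x -> 0 < y -> 0 < t * x + (1 - t) * y.
Proof. by move=> /andP[t0 t1] x0 y0; nra. Qed.

(** Average the tangent plane inequalities at the mixed point: the linear terms
    cancel, because the tangent plane touches the graph there. *)
Lemma relative_entropy_convex (R : realType) (t x0 x1 y0 y1 : R) :
  0 <= t <= 1 -> 0 < x0 -> 0 < x1 -> 0 < y0 -> 0 < y1 ->
  (t * x0 + (1 - t) * x1)
    * (ln (t * x0 + (1 - t) * x1) - ln (t * y0 + (1 - t) * y1)) <=
  t * (x0 * (ln x0 - ln y0)) + (1 - t) * (x1 * (ln x1 - ln y1)).
Proof.
move=> /andP[t0 t1] x00 x10 y00 y10.
set x := t * x0 + (1 - t) * x1; set y := t * y0 + (1 - t) * y1.
have x_gt0 : 0 < x by apply: mix_gt0; rewrite ?t0.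
have y_gt0 : 0 < y by apply: mix_gt0; rewrite ?t0.
have H0 := relative_entropy_tangent x00 y00 x_gt0 y_gt0.
have H1 := relative_entropy_tangent x10 y10 x_gt0 y_gt0.
have s0 : 0 <= 1 - t by rewrite subr_ge0.
apply: le_trans (lerD (ler_wpM2l t0 H0) (ler_wpM2l s0 H1)).
rewrite le_eqVlt; apply/orP; left; apply/eqP.
transitivity (x * (ln x - ln y) + x - y * (x / y)).
  by field; rewrite gt_eqF.
by move: (ln x - ln y) (x / y) => D q; rewrite /x /y; ring.
Qed.

(** * Concavity of the entropy in terms of the inverse kernel *)

Section mmatrix.
Context (R : realType) (I : finType) (A : I -> I -> R).

(** Minus the entropy of the masses A f, in terms of their potential f. *)
Definition dual_entropy (f : I -> R) : R :=
  \sum_i (\sum_j A i j * f j) * ln (f i).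

(** Subtracting ln (f j) from every ln (f i) in the column j makes the diagonal
    terms vanish, so that every remaining A i j has a known sign. The term ln 1
    exhibits f ln f as a relative entropy too. *)
Lemma dual_entropyE (f : I -> R) :
  dual_entropy f = \sum_j ((\sum_i A i j) * (f j * (ln (f j) - ln 1)) +
    \sum_(i | i != j) - A i j * (f j * (ln (f j) - ln (f i)))).
Proof.
rewrite /dual_entropy; under eq_bigr do rewrite mulr_suml.
rewrite exchange_big; apply: eq_bigr => j _ /=.
rewrite ln1 subr0 mulr_suml (bigD1 j)//= [in RHS](bigD1 j)//= -addrA.
rewrite -mulrA -big_split/=; congr (_ + _); apply: eq_bigr => i _.
by ring.
Qed.

Hypothesis A_offdiag : forall i j, i != j -> A i j <= 0.
Hypothesis A_colsum : forall j, 0 <= \sum_i A i j.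

Lemma dual_entropy_convex (t : R) (f g : I -> R) : 0 <= t <= 1 ->
  (forall i, 0 < f i) -> (forall i, 0 < g i) ->
  dual_entropy (fun i => t * f i + (1 - t) * g i) <=
  t * dual_entropy f + (1 - t) * dual_entropy g.
Proof.
move=> t01 f0 g0; rewrite !dual_entropyE !mulr_sumr -big_split/=.
apply: ler_sum => j _.
rewrite [in leRHS]mulrDr [X in _ <= _ + X]mulrDr addrACA; apply: lerD.
  have := relative_entropy_convex t01 (f0 j) (g0 j) ltr01 ltr01.
  rewrite /= !mulr1 [t + _]addrC subrK => /(ler_wpM2l (A_colsum j)).
  by move/le_trans; apply; rewrite le_eqVlt; apply/orP/or_introl/eqP; ring.
rewrite !mulr_sumr -big_split/=; apply: ler_sum => i ij.
have := relative_entropy_convex t01 (f0 j) (g0 j) (f0 i) (g0 i).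
have A0 : 0 <= - A i j by rewrite oppr_ge0 A_offdiag.
move=> /= /(ler_wpM2l A0).
by move/le_trans; apply; rewrite le_eqVlt; apply/orP/or_introl/eqP; ring.
Qed.

End mmatrix.

(** * The geometric kernel and its tridiagonal inverse *)

Section geometric_kernel.
Context (R : realType) (n : nat) (r : R).
Hypothesis r01 : 0 < r < 1.

(** With truncated subtractions, the exponent is the distance of i and j. *)
Definition geometric_kernel (i j : nat) : R := r ^+ ((i - j) + (j - i)).

Definition potential (p : 'I_n -> R) (i : 'I_n) : R :=
  \sum_(j < n) geometric_kernel i j * p j.

(** This is 1 - r^2 times the inverse of the geometric kernel: off the diagonal,
    - r between neighbours; on the diagonal, 1 + r^2 at interior points. Each
    of the two parenthesized blocks is the contribution of one neighbour and
    vanishes at the end where that neighbour is missing. *)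
Definition precision (i j : nat) : R :=
  (j == i)%:R * (1 - r ^+ 2)
  + ((j == i)%:R * (r ^+ 2 * (0 < i)%N%:R) - (i == j.+1)%:R * r)
  + ((j == i)%:R * (r ^+ 2 * (i.+1 < n)%N%:R) - (j == i.+1)%:R * r).

Lemma sum_ord_eq (F : nat -> R) (k : nat) :
  \sum_(j < n) (j == k :> nat)%:R * F j = (k < n)%N%:R * F k.
Proof.
under eq_bigr do rewrite mulr_natl mulrb.
by rewrite -big_mkcond big_ord1_eq mulr_natl mulrb.
Qed.

Lemma sum_ord_succ_eq (F : nat -> R) (k : nat) : (k <= n)%N ->
  \sum_(j < n) (k == j.+1)%:R * F j = (0 < k)%N%:R * F k.-1.
Proof.
case: k => [|k] kn; first by rewrite mul0r big1// => j _; rewrite mul0r.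
under eq_bigr do rewrite eqSS eq_sym.
by rewrite sum_ord_eq kn.
Qed.

Lemma precision_offdiag (i j : 'I_n) : i != j -> precision i j <= 0.
Proof.
move=> ij; have {}ij : (nat_of_ord j == i) = false.
  by apply/negbTE; rewrite eq_sym.
have /andP[r0 _] := r01.
have H (b : bool) : - (b%:R * r) <= 0 by rewrite oppr_le0 mulr_ge0// ltW.
rewrite /precision ij !mul0r add0r !sub0r.
by rewrite -(addr0 0) lerD.
Qed.

(** The sum is 1 - r^2, less r - r^2 for each of the at most two neighbours of
    j, hence at least (1 - r)^2. *)
Lemma precision_colsum (j : 'I_n) : 0 <= \sum_(i < n) precision i j.
Proof.
have -> : \sum_(i < n) precision i j =
   (1 - r ^+ 2) + ((0 < j)%N%:R + (j.+1 < n)%N%:R) * (r ^+ 2 - r).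
  rewrite /precision; under eq_bigr do rewrite (eq_sym (nat_of_ord j)).
  rewrite !big_split/= !sumrN.
  rewrite (sum_ord_eq (fun=> 1 - r ^+ 2)) (sum_ord_eq (fun i => r ^+ 2 * (0 < i)%N%:R)).
  rewrite (sum_ord_eq (fun i => r ^+ 2 * (i.+1 < n)%N%:R)).
  rewrite (sum_ord_succ_eq (fun=> r)) ?(ltnW (ltn_ord j))//.
  rewrite (sum_ord_eq (fun=> r)) ltn_ord mulr1n !mul1r.
  by ring.
have /andP[r0 r1] := r01.
by case: (0 < j)%N; case: (j.+1 < n)%N => /=; nra.
Qed.

(** Geometric sequences solve (1 + r^2) u i = r u (i - 1) + r u (i + 1), so only
    the kink of the kernel at i = k contributes. Dropping the block of a missing
    neighbour is harmless: continued beyond the end, the kernel is geometric on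
    that side, and the block would be 0. *)
Lemma precision_kernel (i k : 'I_n) :
  \sum_(j < n) precision i j * geometric_kernel j k = (k == i)%:R * (1 - r ^+ 2).
Proof.
transitivity (
    (1 - r ^+ 2) * geometric_kernel i k
  + (0 < i)%N%:R * (r ^+ 2 * geometric_kernel i k - r * geometric_kernel i.-1 k)
  + (i.+1 < n)%N%:R *
      (r ^+ 2 * geometric_kernel i k - r * geometric_kernel i.+1 k)).
  pose G c j := c * geometric_kernel j k.
  rewrite (eq_bigr (fun j : 'I_n => (nat_of_ord j == i)%:R * G (1 - r ^+ 2) j
    + ((nat_of_ord j == i)%:R * G (r ^+ 2 * (0 < i)%N%:R) j
       - (nat_of_ord i == j.+1)%:R * G r j)
    + ((nat_of_ord j == i)%:R * G (r ^+ 2 * (i.+1 < n)%N%:R) j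
       - (nat_of_ord j == i.+1)%:R * G r j))).
    rewrite !big_split/= !sumrN !sum_ord_eq.
    rewrite sum_ord_succ_eq ?(ltnW (ltn_ord i))// /G ltn_ord mulr1n !mul1r.
    by ring.
  by move=> j _; rewrite /precision /G; ring.
rewrite /geometric_kernel.
(* The exponents are normalized to powers of the distance of i and k, minus 1. *)
case: (ltngtP i k) => [ik|ki|]; last first.
- move=> /val_inj ->; rewrite eqxx subnn.
  have -> : (k.+1 - k + (k - k.+1) = 1)%N by lia.
  have [->|k0] := posnP k; first by rewrite mulr1n mulr0n expr0 expr1; ring.
  have -> : (k.-1 - k + (k - k.-1) = 1)%N by lia.
  by rewrite mulr1n expr0 expr1; ring.
- have -> : (k == i) = false by apply/eqP => E; rewrite E ltnn in ki.
  have -> : (i - k + (k - i) = (i - k).-1.+1)%N by lia.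
  have -> : (i.-1 - k + (k - i.-1) = (i - k).-1)%N by lia.
  have -> : (i.+1 - k + (k - i.+1) = (i - k).-1.+2)%N by lia.
  by rewrite (leq_ltn_trans _ ki)// mulr1n mulr0n !exprS; ring.
- have -> : (k == i) = false by apply/eqP => E; rewrite E ltnn in ik.
  have -> : (i - k + (k - i) = (k - i).-1.+1)%N by lia.
  have -> : (i.+1 - k + (k - i.+1) = (k - i).-1)%N by lia.
  rewrite (leq_ltn_trans ik)//.
  have [->|i0] := posnP i; first by rewrite mulr1n mulr0n !exprS; ring.
  have -> : (i.-1 - k + (k - i.-1) = (k - i).-1.+2)%N by lia.
  by rewrite mulr1n mulr0n !exprS; ring.
Qed.

Lemma precision_potential (p : 'I_n -> R) (i : 'I_n) :
  \sum_(j < n) precision i j * potential p j = (1 - r ^+ 2) * p i.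
Proof.
under eq_bigr do rewrite mulr_sumr; rewrite exchange_big/=.
under eq_bigr => k _.
  under eq_bigr do rewrite mulrA.
  rewrite -mulr_suml precision_kernel -mulrA; over.
rewrite (bigD1 i)//= eqxx mul1r big1 ?addr0// => k /negbTE->.
by rewrite mul0r.
Qed.

Definition grid_entropy (p : 'I_n -> R) : R :=
  - \sum_i p i * ln (potential p i).

Lemma grid_entropy_concave (t : R) (p q : 'I_n -> R) : 0 <= t <= 1 ->
  (forall i, 0 < potential p i) -> (forall i, 0 < potential q i) ->
  t * grid_entropy p + (1 - t) * grid_entropy q <=
  grid_entropy (fun i => t * p i + (1 - t) * q i).
Proof.
move=> t01 p0 q0.
pose A (i j : 'I_n) := precision i j.
have c0 : 0 < 1 - r ^+ 2 by have /andP[r0 r1] := r01; nra.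
have E u : (1 - r ^+ 2) * - grid_entropy u = dual_entropy A (potential u).
  rewrite opprK mulr_sumr; apply: eq_bigr => i _.
  by rewrite precision_potential mulrA.
have := @dual_entropy_convex _ _ A precision_offdiag precision_colsum t _ _ t01 p0 q0.
have -> : (fun i => t * potential p i + (1 - t) * potential q i) =
    potential (fun i => t * p i + (1 - t) * q i).
  apply/funext => i; rewrite /potential !mulr_sumr -big_split/=.
  by apply: eq_bigr => j _; ring.
rewrite -!E [t * _]mulrCA [(1 - t) * _]mulrCA -mulrDr ler_pM2l//.
lra.
Qed.

End geometric_kernel.

(** * Integrals over a finite partition up to a null set *)

Section integral_partition.
Context d (T : measurableType d) (R : realType) (mu : probability T R).
Context (n : nat) (F : 'I_n -> set T) (g : T -> \bar R) (c : 'I_n -> R).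
Hypothesis mF : forall i, measurable (F i).
Hypothesis tF : trivIset setT F.
Hypothesis muF : mu (~` \big[setU/set0]_i F i) = 0%E.
Hypothesis mg : measurable_fun setT g.
Hypothesis g0 : forall x, (0 <= g x)%E.

Lemma integral_partition :
  (\int[mu]_x g x = \sum_i \int[mu]_(x in F i) g x)%E.
Proof.
have mU : measurable (\big[setU/set0]_i F i) by exact: bigsetU_measurable.
rewrite (ge0_negligible_integral (N := ~` \big[setU/set0]_i F i))//; last first.
  exact: measurableC.
rewrite setTD setCK ge0_integral_bigsetU//.
- exact: index_enum_uniq.
- exact: sub_trivIset tF.
- exact: measurable_funTS.
Qed.

Lemma integral_cell_cst (i : 'I_n) :
  (\int[mu]_(x in F i) cst (c i)%:E x = (c i * fine (mu (F i)))%:E)%E.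
Proof. by rewrite integral_cst// EFinM fineK// fin_num_measure. Qed.

Lemma integral_partition_le : (forall i x, F i x -> (g x <= (c i)%:E)%E) ->
  (\int[mu]_x g x <= (\sum_i c i * fine (mu (F i)))%:E)%E.
Proof.
move=> gc; rewrite integral_partition -sumEFin; apply: lee_sum => i _.
rewrite -integral_cell_cst; apply: ge0_le_integral => //.
- exact: measurable_funTS.
- by move=> x Fx; exact: gc.
Qed.

Lemma integral_partition_ge : (forall i x, F i x -> ((c i)%:E <= g x)%E) ->
  ((\sum_i c i * fine (mu (F i)))%:E <= \int[mu]_x g x)%E.
Proof.
move=> gc; rewrite integral_partition -sumEFin; apply: lee_sum => i _.
(* A negative bound is not below the integral by monotonicity of integrals of
   nonnegative functions, but trivially so. *)
have [c0|c0] := leP 0 (c i).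
  rewrite -integral_cell_cst; apply: ge0_le_integral => //.
  - exact: measurable_funTS.
  - by move=> x Fx; exact: gc.
apply: (@le_trans _ _ 0%E); last by apply: integral_ge0 => x _; exact: g0.
by rewrite lee_fin mulr_le0_ge0 ?fine_ge0// ltW.
Qed.

Lemma sum_partition : \sum_i fine (mu (F i)) = 1.
Proof.
have mU : measurable (\big[setU/set0]_i F i) by exact: bigsetU_measurable.
apply: EFin_inj; rewrite -sumEFin.
under eq_bigr do rewrite fineK ?fin_num_measure//.
rewrite -measure_bigsetU_ord//.
have := probability_setC mu mU; rewrite muF => /esym/eqP.
rewrite sube_eq ?fin_num_measure// add0e => /eqP; exact: esym.
Qed.

End integral_partition.

(** * The potential of a probability measure *)

Section laplace_potential.
Context (R : realType) (mu : probability (measurableTypeR R) R).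
Local Notation K := (@laplace_kernel R).

Lemma laplace_kernel_gt0 (s t : R) : 0 < K s t.
Proof. exact: expR_gt0. Qed.

Lemma laplace_kernel_le1 (s t : R) : K s t <= 1.
Proof. by rewrite /laplace_kernel expR_le1 oppr_le0. Qed.

Lemma measurable_laplace_kernel2 :
  measurable_fun setT (fun z : measurableTypeR R * measurableTypeR R => (K z.1 z.2)%:E).
Proof.
apply/measurable_EFinP; apply: measurableT_comp => //.
apply: measurableT_comp => //; apply: measurableT_comp => //.
by apply: measurable_funB.
Qed.

Lemma measurable_laplace_kernel (s : R) :
  measurable_fun setT (fun t : measurableTypeR R => (K s t)%:E).
Proof.
apply/measurable_EFinP; apply: measurableT_comp => //.
apply: measurableT_comp => //; apply: measurableT_comp => //.
by apply: measurable_funB.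
Qed.

Definition laplace_potential (s : R) : \bar R := (\int[mu]_t (K s t)%:E)%E.

Lemma measurable_laplace_potential :
  measurable_fun setT (laplace_potential : measurableTypeR R -> \bar R).
Proof.
apply: (@measurable_fun_fubini_tonelli_F _ _ (measurableTypeR R) (measurableTypeR R)
  R mu (fun z => (K z.1 z.2)%:E)).
  exact: measurable_laplace_kernel2.
by move=> z; rewrite lee_fin ltW// laplace_kernel_gt0.
Qed.

Lemma laplace_potential_le1 (s : R) : (laplace_potential s <= 1)%E.
Proof.
rewrite -(@probability_setT _ _ _ mu) -[leRHS]mul1e -integral_cst//.
apply: ge0_le_integral => //.
- by move=> t _; rewrite lee_fin ltW// laplace_kernel_gt0.
- exact: measurable_laplace_kernel.
- by move=> t _; rewrite lee_fin laplace_kernel_le1.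
Qed.

(** Positivity everywhere, not only near the support, makes the extended
    logarithm of the potential a real function on the whole line, so that its
    measurability reduces to that of the real logarithm. *)
Lemma laplace_potential_gt0 (s : R) : (0 < laplace_potential s)%E.
Proof.
rewrite lt0e; apply/andP; split; last first.
  by apply: integral_ge0 => t _; rewrite lee_fin ltW// laplace_kernel_gt0.
apply/eqP => E0.
have /ae_eq_integral_abs : (\int[mu]_(t in setT) `|(K s t)%:E| = 0)%E.
  rewrite -[RHS]E0; apply: eq_integral => t _.
  by rewrite gee0_abs// lee_fin ltW// laplace_kernel_gt0.
case=> //; first exact: measurable_laplace_kernel.
move=> N [mN muN sN].
have NT : N = setT.
  apply/seteqP; split=> // t _; apply: sN => /=.
  move=> /(_ I)[] /eqP; rewrite gt_eqF//; exact: laplace_kernel_gt0.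
have : mu setT = 0%E by rewrite -NT.
by rewrite probability_setT => /eqP; rewrite eqe oner_eq0.
Qed.

Definition log_potential (s : R) : R := ln (fine (laplace_potential s)).

Lemma fine_laplace_potentialK (s : R) :
  (fine (laplace_potential s))%:E = laplace_potential s.
Proof.
apply: fineK; rewrite ge0_fin_numE ?ltW ?laplace_potential_gt0//.
by apply: le_lt_trans (laplace_potential_le1 s) _; rewrite ltry.
Qed.

Lemma fine_laplace_potential_gt0 (s : R) : 0 < fine (laplace_potential s).
Proof. by rewrite -lte_fin fine_laplace_potentialK laplace_potential_gt0. Qed.

Lemma KentropyE : Kentropy K mu = (\int[mu]_s (- log_potential s)%:E)%E.
Proof.
apply: eq_integral => s _; rewrite -/(laplace_potential s).
by rewrite -fine_laplace_potentialK lne_EFin ?fine_laplace_potential_gt0.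
Qed.

Lemma measurable_log_potential :
  measurable_fun setT (log_potential : measurableTypeR R -> R).
Proof.
apply: measurableT_comp; first exact: measurable_ln.
apply: measurableT_comp; last exact: measurable_laplace_potential.
exact: fine_measurable.
Qed.

Lemma log_potential_le0 (s : R) : log_potential s <= 0.
Proof.
by rewrite ln_le0// -lee_fin fine_laplace_potentialK laplace_potential_le1.
Qed.

End laplace_potential.

(** * Discretization on a grid of mesh h *)

Section grid.
Context (R : realType) (a h : R).
Hypothesis h0 : 0 < h.
Local Notation K := (@laplace_kernel R).
Local Notation r := (expR (- h)).

Definition cell (i : nat) : set (measurableTypeR R) :=
  `[a + i%:R * h, a + i.+1%:R * h[.

Lemma cell_left (i : nat) : cell i (a + i%:R * h).
Proof. by rewrite /cell /= in_itv/= lexx ltrD2l ltr_pM2r// ltr_nat ltnSn. Qed.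

Lemma measurable_cell (i : nat) : measurable (cell i).
Proof. exact: measurable_itv. Qed.

Lemma trivIset_cell (n : nat) : trivIset setT (fun i : 'I_n => cell i).
Proof.
move=> i j _ _ [x [/=]]; rewrite /cell/= !in_itv/= => /andP[xi ix] /andP[xj jx].
apply/val_inj/eqP; rewrite /= eqn_leq.
have := le_lt_trans xi jx; have := le_lt_trans xj ix.
by rewrite !ltrD2l !ltr_pM2r// !ltr_nat !ltnS => -> ->.
Qed.

Lemma itv_sub_cells (b : R) : a <= b ->
  `[a, b] `<=` \big[setU/set0]_(i < (Num.truncn ((b - a) / h)).+1) cell i.
Proof.
move=> ab x /=; rewrite in_itv/= => /andP[ax xb].
have d0 : 0 <= (x - a) / h by rewrite divr_ge0 ?subr_ge0// ltW.
have /andP[t1 t2] := truncn_itv d0.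
have tb : (Num.truncn ((x - a) / h) < (Num.truncn ((b - a) / h)).+1)%N.
  by rewrite ltnS; apply: le_truncn; rewrite ler_pM2r ?invr_gt0// lerD2r.
rewrite -bigcup_mkord; exists (Num.truncn ((x - a) / h)) => //.
rewrite /cell/= in_itv/=; apply/andP; split.
  by rewrite addrC -lerBrDr -ler_pdivlMr.
by rewrite addrC -ltrBlDr -ltr_pdivrMr.
Qed.

Lemma cell_dist (i j : nat) (s t : R) : cell i s -> cell j t ->
  `| `|s - t| - h * ((i - j) + (j - i))%N%:R | <= h.
Proof.
wlog ij : i j s t / (i <= j)%N.
  move=> H si tj; case/orP: (leq_total i j) => ij; first exact: H.
  by rewrite addnC (distrC s); exact: H.
rewrite /cell/= !in_itv/= => /andP[is1 s_i] /andP[jt tj].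
have -> : (i - j + (j - i))%N = (j - i)%N by lia.
rewrite natrB//.
rewrite -natr1 in s_i; rewrite -natr1 in tj.
have hij : 0 <= h * (j%:R - i%:R) by rewrite mulr_ge0 ?(ltW h0)// subr_ge0 ler_nat.
have [st|st] := leP 0 (s - t); rewrite ler_norml.
  rewrite ger0_norm//; apply/andP; split; nra.
rewrite ltr0_norm//; apply/andP; split; nra.
Qed.

(** The error is multiplicative, so it passes unchanged through the integration
    against mu and becomes the additive error h under the logarithm, however
    small the potential is. *)
Lemma laplace_kernel_cell (i j : nat) (s t : R) : cell i s -> cell j t ->
  K s t <= expR h * geometric_kernel r i j /\
  geometric_kernel r i j <= expR h * K s t.
Proof.
move=> si tj; have := cell_dist si tj.
rewrite /geometric_kernel /laplace_kernel -expRM_natr -!expRD !ler_expR.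
by rewrite ler_norml => /andP[? ?]; split; lra.
Qed.

Lemma geometric_ratio_itv : 0 < r < 1.
Proof. by rewrite expR_gt0 expR_lt1 oppr_lt0. Qed.

Section entropy.
Context (n : nat) (mu : probability (measurableTypeR R) R).
Hypothesis mu_cells : mu (~` \big[setU/set0]_(i < n) cell i) = 0%E.

Definition cell_mass (i : 'I_n) : R := fine (mu (cell i)).

Local Notation f := (potential r cell_mass).
Local Notation F := (fun s => fine (laplace_potential mu s)).

Lemma laplace_potential_cell (i : 'I_n) (s : R) : cell i s ->
  F s <= expR h * f i /\ f i <= expR h * F s.
Proof.
move=> si.
have mF (j : 'I_n) : measurable (cell j) by exact: measurable_cell.
have K0 (t : R) : (0 <= (K s t)%:E)%E.
  by rewrite lee_fin ltW// laplace_kernel_gt0.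
have mK := measurable_laplace_kernel s.
split.
  rewrite -lee_fin fine_laplace_potentialK mulr_sumr.
  under eq_bigr do rewrite mulrA.
  apply: integral_partition_le => //; first exact: trivIset_cell.
  by move=> j t tj; rewrite lee_fin; have [] := laplace_kernel_cell si tj.
rewrite -ler_pdivrMl ?expR_gt0// -lee_fin fine_laplace_potentialK mulr_sumr.
under eq_bigr do rewrite mulrA.
apply: integral_partition_ge => //; first exact: trivIset_cell.
move=> j t tj; rewrite lee_fin ler_pdivrMl ?expR_gt0//.
by have [] := laplace_kernel_cell si tj.
Qed.

(** Every cell contains a point, and the potential of mu is positive there; so f
    is positive even on cells of mass 0. *)
Lemma potential_gt0 (i : 'I_n) : 0 < f i.
Proof.
have [+ _] := laplace_potential_cell (cell_left i).
move/(lt_le_trans (fine_laplace_potential_gt0 _ _)).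
by rewrite pmulr_rgt0 ?expR_gt0.
Qed.

Lemma log_potential_cell (i : 'I_n) (s : R) : cell i s ->
  `|log_potential mu s - ln (f i)| <= h.
Proof.
move=> si; have [Ff fF] := laplace_potential_cell si.
have F0 := fine_laplace_potential_gt0 mu s; have f0 := potential_gt0 i.
have e0 := expR_gt0 h.
have H (x y : R) : 0 < x -> 0 < y -> x <= expR h * y -> ln x <= h + ln y.
  move=> x0 y0 xy; rewrite -[X in X + _]expRK -lnM ?posrE//.
  by rewrite ler_ln ?posrE// mulr_gt0.
have := H _ _ F0 f0 Ff; have := H _ _ f0 F0 fF.
by rewrite /log_potential ler_norml => ? ?; apply/andP; split; lra.
Qed.

Lemma Kentropy_grid :
  ((grid_entropy r cell_mass - h)%:E <= Kentropy K mu)%E /\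
  (Kentropy K mu <= (grid_entropy r cell_mass + h)%:E)%E.
Proof.
have mF (j : 'I_n) : measurable (cell j) by exact: measurable_cell.
have S1 := sum_partition mF (@trivIset_cell n) mu_cells.
have mL : measurable_fun setT (fun s : measurableTypeR R => (- log_potential mu s)%:E).
  apply/measurable_EFinP; apply: measurableT_comp => //.
  exact: measurable_log_potential.
have L0 (s : measurableTypeR R) : (0 <= (- log_potential mu s)%:E)%E.
  by rewrite lee_fin oppr_ge0 log_potential_le0.
have E c : \sum_i (- ln (f i) + c) * cell_mass i = grid_entropy r cell_mass + c.
  under eq_bigr do rewrite mulrDl mulNr mulrC.
  by rewrite big_split/= -mulr_sumr S1 mulr1 sumrN.
rewrite KentropyE; split; rewrite -E.
  apply: integral_partition_ge => //; first exact: trivIset_cell.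
  move=> i s si; rewrite lee_fin.
  by have := log_potential_cell si; rewrite ler_norml => /andP[? ?]; lra.
apply: integral_partition_le => //; first exact: trivIset_cell.
move=> i s si; rewrite lee_fin.
by have := log_potential_cell si; rewrite ler_norml => /andP[? ?]; lra.
Qed.

End entropy.
End grid.

Unset Implicit Arguments.

Theorem theorem6p5 (R : realType) (a b : R) (hab : a <= b)
    (mu0 mu1 : probability (measurableTypeR R) R)
    (hmu0 : supported_on mu0 `[a, b]) (hmu1 : supported_on mu1 `[a, b])
    (l : {i01 R}) :
  (l%:num%:E * Kentropy (@laplace_kernel R) mu0
     + (1 - l%:num)%:E * Kentropy (@laplace_kernel R) mu1
   <= Kentropy (@laplace_kernel R) (mixture l mu0 mu1))%E.
Proof.
apply/lee_addgt0Pr => e e0.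
(* The mesh is half of the error, because both sides are discretized. *)
have h0 : 0 < e / 2 by rewrite divr_gt0.
set h := e / 2 in h0.
set n := (Num.truncn ((b - a) / h)).+1.
set C := \big[setU/set0]_(i < n) cell a h i.
have mC : measurable C.
  by apply: bigsetU_measurable => i _; exact: measurable_cell.
have null (mu : probability (measurableTypeR R) R) :
    supported_on mu `[a, b] -> mu (~` C) = 0%E.
  move=> H; apply/eqP; rewrite -measure_le0 -H; apply: le_measure.
  - by rewrite inE; exact: measurableC.
  - by rewrite inE; apply: measurableC; exact: measurable_itv.
  - by apply: subsetC; exact: itv_sub_cells.
pose mu : probability (measurableTypeR R) R := mixture l mu0 mu1.
have muE A : (mu A = l%:num%:E * mu0 A + (1 - l%:num)%:E * mu1 A)%E.
  exact: mixtureE.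
have n0 := null _ hmu0; have n1 := null _ hmu1.
have nu : mu (~` C) = 0%E by rewrite muE n0 n1 !mule0 adde0.
have l01 : 0 <= l%:num <= 1 by rewrite ge0 le1.
have [_ U0] := Kentropy_grid h0 n0.
have [_ U1] := Kentropy_grid h0 n1.
have [L _] := Kentropy_grid h0 nu.
have massE : @cell_mass R a h n mu = (fun i => l%:num * cell_mass a h mu0 i +
    (1 - l%:num) * cell_mass a h mu1 i).
  apply/funext => i; have mi := measurable_cell a h i.
  have F0 := fin_num_measure mu0 _ mi; have F1 := fin_num_measure mu1 _ mi.
  by rewrite /cell_mass muE fineD ?fineM ?fin_numM.
have := grid_entropy_concave (geometric_ratio_itv h0) l01
  (potential_gt0 h0 n0) (potential_gt0 h0 n1).
rewrite -massE => C1.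
have /andP[l0 l1] := l01.
have s0 : 0 <= 1 - l%:num by rewrite subr_ge0.
have l0E : (0 <= l%:num%:E :> \bar R)%E by rewrite lee_fin.
have s0E : (0 <= (1 - l%:num)%:E :> \bar R)%E by rewrite lee_fin.
apply: le_trans (leeD (lee_wpmul2l l0E U0) (lee_wpmul2l s0E U1)) _.
apply: le_trans (leeD2r e%:E L).
rewrite -!EFinM -!EFinD lee_fin.
have : e = 2 * h by rewrite /h mulrC divfK.
move: C1; move: (grid_entropy _ _) (grid_entropy _ _) (grid_entropy _ _) => x y z.
nra.
Qed.
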